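(* Let $p$ be a prime and $q$ a power of $p$. Let $r,s$ be positive integers with $r,s,p$ pairwise relatively prime, let $d\ge1$ be an integer prime to $p$, and let $X$ be the smooth projective curve over $\mathbb{F}_q(t)$ associated to $$y^r=\frac{(x^s+1)(x^s+t^{ds})}{x^s}.$$ Let $g=(r-1)s$ (the genus of $X$) and suppose $g>2$. Let $(x,y)$ be an $\mathbb{F}_q(t)$-rational point on $X$, write $x=u/v$ with $u,v\in\mathbb{F}_q[t]$ and $\gcd(u,v)=1$, and let $\delta=\max\{\deg u,\deg v\}$. If $x$ is not a $p$-th power in $\mathbb{F}_q(t)$, then $$\delta\le\frac{dg-1}{g-2},$$ and if $x$ is a $p$-th power in $\mathbb{F}_q(t)$, then $$\delta\le\frac{2d(g-1)-1}{g-2}.$$ *)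

(* Defs.v *)
From mathcomp Require Import all_boot all_order all_algebra.

Set Implicit Arguments.
Unset Strict Implicit.
Unset Printing Implicit Defensive.

Import Order.TTheory GRing.Theory Num.Theory.
Local Open Scope ring_scope.

Definition ratfun (F : fieldType) : fieldType := {fraction {poly F}}.

Definition poly_ratfun (F : fieldType) (u : {poly F}) : ratfun F := tofrac u.

(* The K-rational points of the smooth projective curve attached to            *)
(*   y^r = f(x),  f(x) = (x^s + 1)(x^s + t^(ds)) / x^s,  K = F(t),             *)
(* with values of the coordinate functions x, y in P^1(K) = option K,          *)
(* [None] being the point at infinity.  When r, s are prime to the             *)
(* characteristic and d > 0, the zeros of f are simple, so the affine equation *)
(* is already smooth where x <> 0.  The poles of f are x = 0 and x = infinity, *)
(* both of order s; as r and s are coprime the covering x : X -> P^1 is        *)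
(* totally ramified there, so that each carries exactly one point, which is    *)
(* rational and at which y has a pole.                                         *)
(* The test x != 0 cannot be dropped from the affine part: since 0^-1 = 0, the *)
(* equation would otherwise be satisfied by the spurious pair (0, 0).          *)
Definition on_curve (F : fieldType) (r s d : nat)
    (P : option (ratfun F) * option (ratfun F)) : Prop :=
  let t : ratfun F := poly_ratfun 'X in
  match P with
  | (Some x, Some y) =>
      x != 0 /\ y ^+ r = (x ^+ s + 1) * (x ^+ s + t ^+ (d * s)) / x ^+ s
  | (Some x, None) => x = 0
  | (None, Some _) => False
  | (None, None) => True
  end.

Definition is_power (K : fieldType) (n : nat) (x : K) : Prop :=
  exists z : K, x = z ^+ n.

(* The junk value [degree 0 = 0] is harmless below: if u = 0 and u, v are      *)
(* coprime then v is a nonzero constant.                                       *)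
Definition degree (F : fieldType) (u : {poly F}) : nat := (size u).-1.

(* Main.v *)
Require Import Defs.
From mathcomp Require Import all_boot all_order all_algebra all_field generic_quotient.
From mathcomp Require Import zify ring lra.

(* Write x = u/v in lowest terms, A = u^s + v^s, B = u^s + t^(ds) v^s, so that
   (uv)^s A B is, up to r-th powers, an r-th power.  Away from t = 0 and the
   roots of t^(ds) = 1 the polynomials u, v, A, B have no common zeros, so r
   divides the order of vanishing of each of them.

   If x is not a p-th power, the Wronskian D = u'v - uv' is nonzero.  Like a
   Riemann-Hurwitz count for x over 0, infinity and the roots of x^s = -1, it
   vanishes to order at least e - 1 wherever uvA vanishes to order e.  Hence
   (uvA)^(r-1) divides D^r (t (t^(ds) - 1))^(r-1), and comparing degrees gives
   the bound.

   If x is a p-th power, then u' = v' = 0 and B' = ds t^(ds-1) v^s, so the zeros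
   of B other than t = 0 are simple, hence lie over t^(ds) = 1.  Thus B divides
   t^(ds) (t^(ds) - 1), and delta <= 2d.

   Multiplicities are computed over an algebraic closure of F. *)

Set Implicit Arguments.
Unset Strict Implicit.

Import Order.TTheory GRing.Theory Num.Theory.
Local Open Scope ring_scope.

(** * Wronskians of polynomials *)

Definition wronskian (R : nzRingType) (f g : {poly R}) : {poly R} :=
  f^`() * g - f * g^`().

Lemma wronskianN (R : comNzRingType) (f g : {poly R}) :
  wronskian f g = - wronskian g f.
Proof. rewrite /wronskian; ring. Qed.

Lemma wronskian_exp (R : comNzRingType) (s : nat) (u v : {poly R}) :
  wronskian (u ^+ s) (v ^+ s) = s%:R * (u * v) ^+ s.-1 * wronskian u v.
Proof.
rewrite /wronskian !deriv_exp; case: s => [|s] /=.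
  by rewrite !mulr0n !mul0r mulr0 subrr.
rewrite -[_ * u ^+ s *+ _]mulr_natr -[_ * v ^+ s *+ _]mulr_natr !exprS exprMn; ring.
Qed.

Lemma wronskian_addl (R : comNzRingType) (f g : {poly R}) :
  wronskian (f + g) g = wronskian f g.
Proof. rewrite /wronskian derivD; ring. Qed.

Lemma dvdp_exp_deriv (K : fieldType) (n : nat) (D f : {poly K}) :
  D ^+ n.+1 %| f -> D ^+ n %| f^`().
Proof.
move=> /dvdpP[h ->]; rewrite derivM deriv_exp /=.
rewrite dvdp_add // ?exprS ?dvdp_mull ?dvdp_mulr //.
by rewrite -mulr_natr -mulrA mulrCA dvdp_mulr.
Qed.

Lemma dvdp_exp_wronskian (K : fieldType) (n : nat) (D f g : {poly K}) :
  D ^+ n.+1 %| f -> D ^+ n %| wronskian f g.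
Proof.
move=> Df; rewrite dvdp_sub ?dvdp_mulr ?dvdp_exp_deriv //.
by apply: dvdp_trans Df; rewrite exprS dvdp_mull.
Qed.

(** * Degrees *)

Lemma size_degree (K : fieldType) (f : {poly K}) :
  f != 0 -> size f = (degree f).+1.
Proof. exact: polySpred. Qed.

Lemma degreeM (K : fieldType) (f g : {poly K}) :
  f != 0 -> g != 0 -> degree (f * g) = (degree f + degree g)%N.
Proof.
move=> f0 g0; apply: succn_inj; rewrite -size_degree ?mulf_neq0 //.
by rewrite size_mul // !size_degree // addnS.
Qed.

Lemma degree_exp (K : fieldType) (f : {poly K}) (n : nat) :
  degree (f ^+ n) = (degree f * n)%N.
Proof. exact: size_exp. Qed.

Lemma degree_Xn (K : fieldType) (n : nat) : degree ('X^n : {poly K}) = n.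
Proof. by rewrite degree_exp /degree size_polyX mul1n. Qed.

Lemma degreeN (K : fieldType) (f : {poly K}) : degree (- f) = degree f.
Proof. by rewrite /degree size_polyN. Qed.

Lemma degree_deriv (K : fieldType) (f : {poly K}) :
  f^`() != 0 -> (degree f^`() < degree f)%N.
Proof.
move=> df0; have f0 : f != 0 by apply: contraNneq df0 => ->; rewrite deriv0.
by rewrite -ltnS -!size_degree // lt_size_deriv.
Qed.

Lemma degreeD (K : fieldType) (f g : {poly K}) :
  (degree (f + g) <= maxn (degree f) (degree g))%N.
Proof.
rewrite /degree; have := size_polyD f g.
by move: (size _) (size _) (size _) => m n k; lia.
Qed.

Lemma degree_wronskian (K : fieldType) (f g : {poly K}) :
  wronskian f g != 0 -> (degree (wronskian f g) < degree f + degree g)%N.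
Proof.
suff lt_deg (f1 g1 : {poly K}) :
    f1^`() * g1 != 0 -> (degree (f1^`() * g1) < degree f1 + degree g1)%N.
  rewrite /wronskian; have [->|fg0] := eqVneq (f^`() * g) 0.
    by rewrite sub0r oppr_eq0 degreeN addnC mulrC; apply: lt_deg.
  have [->|gf0] := eqVneq (f * g^`()) 0; first by rewrite subr0 => /lt_deg.
  move=> _; apply: leq_ltn_trans (degreeD _ _) _.
  by rewrite degreeN gtn_max lt_deg //= addnC mulrC lt_deg // mulrC.
move=> fg0; have := fg0; rewrite mulf_eq0 negb_or => /andP[df0 g0].
by rewrite degreeM // ltn_add2r degree_deriv.
Qed.

(** * Orders of vanishing *)

Lemma mup_geq1 (K : fieldType) (c : K) (f : {poly K}) :
  f != 0 -> (0 < mup c f)%N = root f c.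
Proof. by move=> f0; rewrite -XsubC_dvd // dvdp_XsubCl. Qed.

Lemma mupN (K : fieldType) (c : K) (f : {poly K}) : mup c (- f) = mup c f.
Proof. by rewrite -mulN1r -polyCN mupMr // rootC oppr_eq0 oner_eq0. Qed.

Lemma mup_exp (K : fieldType) (c : K) (f : {poly K}) (n : nat) :
  f != 0 -> mup c (f ^+ n) = (n * mup c f)%N.
Proof.
move=> f0; elim: n => [|n IHn]; first by rewrite expr0 mupNroot ?root1.
by rewrite exprS mupM ?expf_neq0 // IHn mulSn.
Qed.

Lemma mup_deriv (K : fieldType) (c : K) (f : {poly K}) :
  f != 0 -> f^`() != 0 -> (mup c f <= (mup c f^`()).+1)%N.
Proof.
move=> f0 df0; case m: (mup c f) => [//|n]; rewrite ltnS mup_geq //.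
by apply: dvdp_exp_deriv; rewrite -mup_geq // m.
Qed.

Lemma mup_wronskian (K : fieldType) (c : K) (f g : {poly K}) :
  f != 0 -> wronskian f g != 0 -> (mup c f <= (mup c (wronskian f g)).+1)%N.
Proof.
move=> f0 w0; case m: (mup c f) => [//|n]; rewrite ltnS mup_geq //.
by apply: dvdp_exp_wronskian; rewrite -mup_geq // m.
Qed.

(** Over an algebraically closed field a nonconstant [f] has a root, which [g] shares; it is removed
    from both, by induction on the size of [f]. *)
Lemma mup_leq_degree (K : closedFieldType) (f g : {poly K}) :
  f != 0 -> g != 0 -> (forall c, mup c f <= mup c g)%N ->
  (degree f <= degree g)%N.
Proof.
move: {2}(size f) (leqnn (size f)) => n.
elim: n f g => [|n IHn] f g sf f0 g0 le_fg.
  by move: f0; rewrite -size_poly_gt0; lia.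
have [/eqP sf1|/closed_rootP[c fc]] := boolP (size f == 1%N).
  by rewrite /degree sf1.
have gc : root g c by rewrite -mup_geq1 // (leq_trans _ (le_fg c)) // mup_geq1.
case/factor_theorem: fc => f1 Ef; case/factor_theorem: gc => g1 Eg.
have X0 : 'X - c%:P != 0 by rewrite polyXsubC_eq0.
have f10 : f1 != 0 by apply: contraNneq f0; rewrite Ef => ->; rewrite mul0r.
have g10 : g1 != 0 by apply: contraNneq g0; rewrite Eg => ->; rewrite mul0r.
rewrite Ef Eg !degreeM // leq_add2r; apply: IHn => //.
  by move: sf; rewrite Ef size_Mmonic ?monicXsubC // size_XsubC addn2.
by move=> e; have := le_fg e; rewrite Ef Eg !mupM // leq_add2r.
Qed.

(** * Vanishing derivatives and p-th powers *)

Lemma exp_deriv0 (R : comNzRingType) (f : {poly R}) (n : nat) :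
  f^`() = 0 -> (f ^+ n)^`() = 0.
Proof. by move=> df; rewrite deriv_exp df mul0r mul0rn. Qed.

Lemma dvdp_deriv_eq0 (K : fieldType) (f : {poly K}) : f %| f^`() -> f^`() = 0.
Proof.
have [-> _|f0] := eqVneq f 0; first exact: deriv0.
move=> fdf; apply/eqP; apply: contraLR fdf => df0; apply/negP => /(dvdp_leq df0).
by rewrite leqNgt lt_size_deriv.
Qed.

(** From u'v = uv' and coprimality, u divides u', whose size is smaller unless u' = 0; likewise for
    v. *)
Lemma wronskian_eq0 (K : fieldType) (u v : {poly K}) :
  coprimep u v -> wronskian u v = 0 -> u^`() = 0 /\ v^`() = 0.
Proof.
move=> cuv /eqP; rewrite subr_eq0 => /eqP E; split; apply: dvdp_deriv_eq0.
  by rewrite -(Gauss_dvdpl _ cuv) E dvdp_mulr.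
by rewrite coprimep_sym in cuv; rewrite -(Gauss_dvdpr _ cuv) -E dvdp_mull.
Qed.

(** Frobenius is additive, so it acts separately on each monomial. *)
Lemma pchar_poly_exp (R : comNzRingType) (p : nat) (w : {poly R}) :
  p \in [pchar R] -> w ^+ p = map_poly (fun c => c ^+ p) w \Po 'X^p.
Proof.
move=> pR; have pP : p \in [pchar {poly R}] by rewrite pchar_poly.
rewrite /map_poly poly_def linear_sum -(pFrobenius_autE pP) -[w in LHS]coefK poly_def.
rewrite rmorph_sum; apply: eq_bigr => i _ /=.
by rewrite linearZ /= comp_Xn_poly pFrobenius_autE exprZn exprAC.
Qed.

(** Frobenius is injective on the finite field F, hence bijective, so coefficients have p-th roots;
    a zero derivative leaves only exponents divisible by p. *)
Lemma deriv0_exp (F : finFieldType) (p : nat) (u : {poly F}) :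
  p \in [pchar F] -> u^`() = 0 -> exists w, u = w ^+ p.
Proof.
move=> pF du; have p0 := prime_gt0 (pcharf_prime pF).
have surjF (c : F) : exists b, b ^+ p == c.
  have /injF_bij [g _ gK] := fmorph_inj (pFrobenius_aut pF).
  by exists (g c); rewrite -(pFrobenius_autE pF) gK.
pose root_p c := xchoose (surjF c).
have root_pK c : root_p c ^+ p = c by apply/eqP/(xchooseP (surjF c)).
(* The p-th roots of the coefficients at multiples of p; [size u] terms are more than enough. *)
exists (\poly_(i < size u) root_p u`_(p * i)); rewrite pchar_poly_exp //.
apply/polyP => i; rewrite coef_comp_poly_Xn //; case: ifP => [|Npi].
  case/dvdnP => j ->; rewrite mulnK // coef_map_id0 ?expr0n ?gtn_eqF //.
  rewrite coef_poly; case: ltnP => [_|le_uj]; first by rewrite root_pK mulnC.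
  by rewrite expr0n gtn_eqF // nth_default // (leq_trans le_uj) // leq_pmulr.
case: i Npi => [|i]; first by rewrite dvdn0.
(* The coefficient of index i in u' is i+1 times that of index i+1 in u, and p does not divide
   i+1. *)
have /(congr1 (fun f : {poly F} => f`_i)) := du.
rewrite coef_deriv coef0 -mulr_natr => /eqP.
by rewrite mulf_eq0 -(dvdn_pcharf pF) => /orP[/eqP|->].
Qed.

(** * Numerators and denominators in a fraction field *)

Lemma fraction_repr (R : idomainType) (x : {fraction R}) :
  exists n d : R, d != 0 /\ x = tofrac n / tofrac d.
Proof.
have d0 := denom_ratioP (repr x).
exists (\n_(repr x)), (\d_(repr x)); split=> //.
apply: (canRL (mulfK _)); first by rewrite tofrac_eq0.
rewrite -{1}[x]reprK; unlock FracField.tofrac.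
rewrite -[LHS]FracField.pi_mul; apply/eqmodP => /=.
rewrite FracField.equivfE /FracField.mulf.
rewrite !numden_Ratio ?oner_neq0 ?mulf_neq0 ?oner_neq0 //.
by rewrite !mulr1 mulrC.
Qed.

(** * The factors A and B of the curve equation *)

(** Numerator of x^s + 1 for x = u/v, as [facB] is that of x^s + t^(ds); the right side of the curve
    equation is AB/(uv)^s. *)
Definition facA (K : fieldType) (s : nat) (u v : {poly K}) : {poly K} :=
  u ^+ s + v ^+ s.

Definition facB (K : fieldType) (s d : nat) (u v : {poly K}) : {poly K} :=
  u ^+ s + 'X^(d * s) * v ^+ s.

Lemma horner_facA (K : fieldType) (s : nat) (u v : {poly K}) (c : K) :
  (facA s u v).[c] = u.[c] ^+ s + v.[c] ^+ s.
Proof. by rewrite hornerD !horner_exp. Qed.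

Lemma horner_facB (K : fieldType) (s d : nat) (u v : {poly K}) (c : K) :
  (facB s d u v).[c] = u.[c] ^+ s + c ^+ (d * s) * v.[c] ^+ s.
Proof. by rewrite hornerD hornerM !horner_exp hornerX. Qed.

Lemma coprimep_root2 (K : fieldType) (u v : {poly K}) (c : K) :
  coprimep u v -> u.[c] = 0 -> v.[c] != 0.
Proof. by move=> cuv /eqP; apply: coprimep_root. Qed.

Lemma facA_root (K : fieldType) (s : nat) (u v : {poly K}) (c : K) :
  (0 < s)%N -> coprimep u v -> root (facA s u v) c -> ~~ root (u * v) c.
Proof.
move=> s0 cuv; rewrite /root horner_facA hornerM => /eqP A0.
apply/eqP => /eqP; rewrite mulf_eq0 => /orP[/eqP u0|/eqP v0]; move: A0.
  rewrite u0 expr0n gtn_eqF // add0r => /eqP.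
  by rewrite expf_eq0 s0 /= (negPf (coprimep_root2 cuv u0)).
rewrite coprimep_sym in cuv.
rewrite v0 expr0n gtn_eqF // addr0 => /eqP.
by rewrite expf_eq0 s0 /= (negPf (coprimep_root2 cuv v0)).
Qed.

(** At such a c at most one of u, v, A, B vanishes, so the equation modulo r isolates its order; for
    u and v the factor s cancels because r and s are coprime. *)
Lemma curve_mup_dvd (K : fieldType) (r s d : nat) (u v a b : {poly K}) (c : K) :
  coprime r s -> (0 < s)%N -> coprimep u v ->
  u != 0 -> v != 0 -> a != 0 -> b != 0 ->
  facA s u v != 0 -> facB s d u v != 0 ->
  a ^+ r * (u * v) ^+ s = b ^+ r * (facA s u v * facB s d u v) ->
  c != 0 -> c ^+ (d * s) != 1 ->
  [/\ r %| mup c u, r %| mup c v,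
      r %| mup c (facA s u v) & r %| mup c (facB s d u v)]%N.
Proof.
move=> rs s0 cuv u0 v0 a0 b0 A0 B0 /(congr1 (mup c)) E c0 c1.
move: E; rewrite !mupM ?expf_neq0 ?mulf_neq0 // !mup_exp ?mulf_neq0 // mupM // => E.
(* Orders on both sides of the curve equation, taken modulo r. *)
have dvdE : (r %| s * (mup c u + mup c v))%N =
            (r %| mup c (facA s u v) + mup c (facB s d u v))%N.
  by rewrite -(dvdn_addr _ (dvdn_mulr (mup c a) (dvdnn r))) E dvdn_addr ?dvdn_mulr.
have N0 f : f.[c] != 0 -> mup c f = 0%N by exact: mupNroot.
have [uc0|uc] := eqVneq u.[c] 0.
  have vc := coprimep_root2 cuv uc0.
  have mA : mup c (facA s u v) = 0%N.
    by rewrite N0 // horner_facA uc0 expr0n gtn_eqF // add0r expf_neq0.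
  have mB : mup c (facB s d u v) = 0%N.
    by rewrite N0 // horner_facB uc0 expr0n gtn_eqF // add0r mulf_neq0 ?expf_neq0.
  by move: dvdE; rewrite mA mB (N0 v) // addn0 dvdn0 Gauss_dvdr // => ->.
have [vc0|vc] := eqVneq v.[c] 0.
  have mA : mup c (facA s u v) = 0%N.
    by rewrite N0 // horner_facA vc0 expr0n gtn_eqF // addr0 expf_neq0.
  have mB : mup c (facB s d u v) = 0%N.
    by rewrite N0 // horner_facB vc0 expr0n gtn_eqF // mulr0 addr0 expf_neq0.
  by move: dvdE; rewrite mA mB (N0 u) // add0n dvdn0 Gauss_dvdr // => ->.
move: dvdE; rewrite (N0 u) // (N0 v) // muln0 dvdn0.
have [Ac0|Ac] := eqVneq (facA s u v).[c] 0; last first.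
  by rewrite (N0 (facA _ _ _)) // add0n => <-.
rewrite (N0 (facB _ _ _ _)) ?addn0 => [<- //|].
(* A and B cannot vanish together where t^(ds) differs from 1 and v is nonzero. *)
have -> : (facB s d u v).[c] = (facA s u v).[c] + (c ^+ (d * s) - 1) * v.[c] ^+ s.
  by rewrite horner_facA horner_facB; ring.
by rewrite Ac0 add0r mulf_neq0 ?expf_neq0 // subr_eq0.
Qed.

(** * The separable case: ramification counts *)

(** For coprime u, v the factor (uv)^(s-1) has no zero in common with A, so when s is invertible
    multiple zeros of A show up in the Wronskian of u and v. *)
Lemma wronskian_facA (K : fieldType) (s : nat) (u v : {poly K}) :
  wronskian (facA s u v) (v ^+ s) = s%:R * (u * v) ^+ s.-1 * wronskian u v.
Proof. by rewrite wronskian_addl wronskian_exp. Qed.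

Lemma wronskian_facA_neq0 (K : fieldType) (s : nat) (u v : {poly K}) :
  s%:R != 0 :> K -> u != 0 -> v != 0 -> wronskian u v != 0 ->
  wronskian (facA s u v) (v ^+ s) != 0.
Proof.
move=> sK u0 v0 w0; rewrite wronskian_facA !mulf_neq0 ?expf_neq0 ?mulf_neq0 //.
by rewrite -polyC_natr polyC_eq0.
Qed.

Lemma facA_neq0 (K : fieldType) (s : nat) (u v : {poly K}) :
  s%:R != 0 :> K -> u != 0 -> v != 0 -> wronskian u v != 0 -> facA s u v != 0.
Proof.
move=> sK u0 v0 w0; have := wronskian_facA_neq0 sK u0 v0 w0.
by apply: contraNneq => ->; rewrite /wronskian deriv0 !mul0r subrr.
Qed.

(* At most one of u, v, A vanishes at c, and each loses at most one order of
   vanishing when it is replaced by the Wronskian of u and v. *)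
Lemma mup_uvA (K : fieldType) (s : nat) (u v : {poly K}) (c : K) :
  s%:R != 0 :> K -> coprimep u v -> u != 0 -> v != 0 -> wronskian u v != 0 ->
  (mup c (u * v * facA s u v) <= (mup c (wronskian u v)).+1)%N.
Proof.
move=> sK cuv u0 v0 w0; have A0 := facA_neq0 sK u0 v0 w0.
have s0 : (0 < s)%N by case: (s) sK => //; rewrite eqxx.
have [Ac|Ac] := boolP (root (facA s u v) c).
  have uvc := facA_root s0 cuv Ac.
  rewrite mupMr // (leq_trans (mup_wronskian _ A0 (wronskian_facA_neq0 sK u0 v0 w0))) //.
  rewrite wronskian_facA mupMr // -polyC_natr rootM rootC (negPf sK) /=.
  by rewrite /root horner_exp expf_eq0 negb_and; move: uvc => ->; rewrite orbT.
rewrite mupMl //; have [uc|uc] := boolP (root u c).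
  by rewrite mupMl ?mup_wronskian //; apply: coprimep_root uc.
rewrite mupMr //; apply: leq_trans (mup_wronskian c v0 (_ : wronskian v u != 0)) _.
  by rewrite wronskianN oppr_eq0.
by rewrite wronskianN mupN.
Qed.

Lemma degree_XnsubC1 (K : fieldType) (n : nat) :
  (0 < n)%N -> degree ('X^n - 1 : {poly K}) = n.
Proof. by move=> n0; rewrite /degree size_XnsubC. Qed.

Lemma XnsubC1_neq0 (K : fieldType) (n : nat) : (0 < n)%N -> 'X^n - 1 != 0 :> {poly K}.
Proof. by move=> n0; rewrite -size_poly_gt0 size_XnsubC. Qed.

Lemma mup_XnsubC1 (K : fieldType) (n : nat) (c : K) :
  (0 < n)%N -> c ^+ n = 1 -> (0 < mup c ('X^n - 1))%N.
Proof.
by move=> n0 cn; rewrite mup_geq1 ?XnsubC1_neq0 // /root !hornerE cn subrr.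
Qed.

(** Local count: m, w, n are the orders of uvA, of the Wronskian and of t (t^(ds) - 1). If n > 0,
    then (r-1)(w+1) is small enough; otherwise a positive m is at least r, and (r-1)m = rm - m <=
    r(w+1) - r. *)
Lemma ramified_leq (r m w n : nat) :
  (0 < r)%N -> (m <= w.+1)%N -> (0 < n)%N || (r %| m)%N ->
  ((r - 1) * m <= r * w + (r - 1) * n)%N.
Proof.
move=> r0 mw /orP[n0|rm].
  apply: (@leq_trans ((r - 1) * w + (r - 1) * n)).
    by rewrite -mulnDr leq_mul2l; apply/orP; right; lia.
  by rewrite leq_add2r leq_mul2r leq_subr orbT.
have [->|m0] := posnP m; first by rewrite muln0.
apply: leq_trans _ (leq_addr _ _); rewrite mulnBl mul1n leq_subLR.
apply: leq_trans (_ : r * w.+1 <= _)%N; first by rewrite leq_mul2l mw orbT.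
by rewrite mulnS leq_add2r dvdn_leq.
Qed.

(** Here m, n, A, w are the degrees of u, v, [facA] and the Wronskian, and M is delta. With k = r -
    1, eliminating A gives ksM <= w + kds, the strict bound on w + sM offsetting the term k due to t
    = 0; then w < m + n. *)
Lemma degree_count (r s d m n A w M : nat) :
  (0 < r)%N -> (w < m + n)%N -> (w + s * M < m + n + A)%N ->
  ((r - 1) * (m + n + A) <= r * w + (r - 1) * (1 + d * s))%N ->
  ((r - 1) * s * M < m + n + d * ((r - 1) * s))%N.
Proof.
case: r => // k _; rewrite subn1 /= => lt_w lt_A le.
have : (k * (w + s * M).+1 <= k * (m + n + A))%N by rewrite leq_mul2l lt_A orbT.
move=> /leq_trans /(_ le) {le lt_A}; rewrite mulnS mulSn !mulnDr muln1.
rewrite !mulnA [(d * k)%N]mulnC; move: (k * w)%N (k * s * M)%N (k * d * s)%N => a b c.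
by lia.
Qed.

(** Degrees in [wronskian_facA]. This is the count at t = infinity: if leading terms cancel in A,
    the degree of the Wronskian is forced down too. *)
Lemma degree_facA (K : fieldType) (s : nat) (u v : {poly K}) :
  s%:R != 0 :> K -> u != 0 -> v != 0 -> wronskian u v != 0 ->
  (degree (wronskian u v) + s * degree u
     < degree u + degree v + degree (facA s u v))%N.
Proof.
move=> sK u0 v0 w0; have := degree_wronskian (wronskian_facA_neq0 sK u0 v0 w0).
rewrite wronskian_facA -polyC_natr !degreeM ?mulf_neq0 ?expf_neq0 ?mulf_neq0 ?polyC_eq0 //.
rewrite !degree_exp degreeM // {1}/degree size_polyC sK /=.
move: (degree _) (degree _) (degree _) (degree _) => m n w A.
case: (s) sK => [|k _ /=]; first by rewrite eqxx.
by clear; rewrite !mulnS mulSn mulnDl ![(_ * k)%N]mulnC; lia.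
Qed.

Lemma separable_bound (K : closedFieldType) (r s d : nat) (u v a b : {poly K}) :
  (0 < r)%N -> (0 < d)%N -> coprime r s -> s%:R != 0 :> K -> coprimep u v ->
  u != 0 -> v != 0 -> a != 0 -> b != 0 -> facB s d u v != 0 ->
  wronskian u v != 0 ->
  a ^+ r * (u * v) ^+ s = b ^+ r * (facA s u v * facB s d u v) ->
  ((r - 1) * s * maxn (degree u) (degree v) < degree u + degree v + d * ((r - 1) * s))%N.
Proof.
move=> r0 d0 rs sK cuv u0 v0 a0 b0 B0 w0 E.
have s0 : (0 < s)%N by case: (s) sK => //; rewrite eqxx.
have ds0 : (0 < d * s)%N by rewrite muln_gt0 d0.
have A0 := facA_neq0 sK u0 v0 w0; have uvA0 : u * v * facA s u v != 0 by rewrite !mulf_neq0.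
have W0 := XnsubC1_neq0 K ds0.
have XW0 : 'X * ('X^(d * s) - 1) != 0 :> {poly K} by rewrite mulf_neq0 ?polyX_eq0.
(* A is symmetric in u and v, so the estimate holds with either degree, hence with their maximum. *)
have degw : (degree (wronskian u v) + s * maxn (degree u) (degree v) <
             degree u + degree v + degree (facA s u v))%N.
  have dAu := degree_facA sK u0 v0 w0.
  have wv0 : wronskian v u != 0 by rewrite wronskianN oppr_eq0.
  have := degree_facA sK v0 u0 wv0; have -> : facA s v u = facA s u v by rewrite /facA addrC.
  by rewrite wronskianN degreeN maxnMr addn_maxr gtn_max dAu [(degree v + _)%N]addnC.
have mult : (degree ((u * v * facA s u v) ^+ (r - 1)) <=
             degree (wronskian u v ^+ r * ('X * ('X^(d * s) - 1)) ^+ (r - 1)))%N.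
  apply: mup_leq_degree; rewrite ?mulf_neq0 ?expf_neq0 // => c.
  rewrite mupM ?expf_neq0 // !mup_exp //.
  have le1 := mup_uvA c sK cuv u0 v0 w0.
  (* In the remaining case [bad] says that t (t^(ds) - 1) does not vanish at c. *)
  apply: ramified_leq r0 le1 _; case: posnP => //= bad.
  have c0 : c != 0.
    by apply: contra_eq_neq bad => ->; rewrite -lt0n mup_geq1 // rootM rootX eqxx.
  have c1 : c ^+ (d * s) != 1.
    apply: contra_eq_neq bad => c1.
    by rewrite -lt0n mupM ?polyX_eq0 // addn_gt0 mup_XnsubC1 ?orbT.
  have [ru rv rA _] := curve_mup_dvd rs s0 cuv u0 v0 a0 b0 A0 B0 E c0 c1.
  by rewrite !mupM ?mulf_neq0 // !dvdn_add.
apply: degree_count r0 (degree_wronskian w0) degw _.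
move: mult; rewrite degreeM ?expf_neq0 // !degree_exp !degreeM ?mulf_neq0 ?polyX_eq0 //.
by rewrite degree_XnsubC1 // {5}/degree size_polyX mulnC
  [(degree (wronskian _ _) * _)%N]mulnC [(_ * (r - 1))%N]mulnC.
Qed.

(** * The inseparable case *)

Lemma inseparable_bound (K : closedFieldType) (r s d : nat) (u v a b : {poly K}) :
  (1 < r)%N -> (0 < d)%N -> coprime r s -> (d * s)%:R != 0 :> K -> coprimep u v ->
  u != 0 -> v != 0 -> a != 0 -> b != 0 -> facA s u v != 0 -> facB s d u v != 0 ->
  u^`() = 0 -> v^`() = 0 ->
  a ^+ r * (u * v) ^+ s = b ^+ r * (facA s u v * facB s d u v) ->
  (maxn (degree u) (degree v) <= 2 * d)%N.
Proof.
move=> r1 d0 rs dsK cuv u0 v0 a0 b0 A0 B0 du dv E.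
have s0 : (0 < s)%N by case: (s) dsK => //; rewrite muln0 eqxx.
have ds0 : (0 < d * s)%N by rewrite muln_gt0 d0.
have W0 := XnsubC1_neq0 K ds0.
have dB : (facB s d u v)^`() = (d * s)%:R%:P * 'X^((d * s).-1) * v ^+ s.
  by rewrite /facB derivD derivM (exp_deriv0 _ du) (exp_deriv0 _ dv) derivXn mulr0 addr0 add0r polyC_natr mulr_natl.
have dB0 : (facB s d u v)^`() != 0.
  by rewrite dB !mulf_neq0 ?expf_neq0 ?polyX_eq0 ?polyC_eq0.
have degB : (d * s + degree v * s <= degree (facB s d u v))%N.
  (* B' has degree ds - 1 + s deg v, strictly below that of B, which absorbs the -1. *)
  have := degree_deriv dB0; rewrite dB !degreeM ?mulf_neq0 ?expf_neq0 ?polyX_eq0 ?polyC_eq0 //.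
  rewrite degree_Xn degree_exp {1}/degree size_polyC dsK /=.
  by move: ds0; move: (degree _) (degree v * s)%N (d * s)%N => m n k; clear; lia.
have degu : (degree u * s <= degree (facB s d u v))%N.
  (* u^s is B minus a term whose degree [degB] already bounds. *)
  rewrite -degree_exp -[u ^+ s](addrK ('X^(d * s) * v ^+ s)).
  apply: leq_trans (degreeD _ _) _; rewrite degreeN degreeM ?expf_neq0 ?polyX_eq0 //.
  by rewrite degree_Xn degree_exp geq_max leqnn.
suff: (degree (facB s d u v) <= degree ('X^(d * s) * ('X^(d * s) - 1) : {poly K}))%N.
  rewrite degreeM ?expf_neq0 ?polyX_eq0 // degree_Xn degree_XnsubC1 //.
  move: degu degB; move: (degree _) (degree _) (degree _) => m n B degu degB degB'.
  rewrite geq_max; apply/andP; split; rewrite -(leq_pmul2r s0) -mulnA;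
  by move: degu degB degB'; move: (m * s)%N (n * s)%N (d * s)%N; clear; lia.
apply: mup_leq_degree; rewrite ?mulf_neq0 ?expf_neq0 ?polyX_eq0 // => c.
rewrite mupM ?expf_neq0 ?polyX_eq0 //.
have [Bc|Bc] := boolP (root (facB s d u v) c); last by rewrite mupNroot.
have vc : v.[c] != 0.
  apply/eqP => vc; move: Bc; rewrite /root horner_facB vc expr0n gtn_eqF // mulr0 addr0.
  rewrite coprimep_sym in cuv.
  by rewrite expf_eq0 s0 /= (negPf (coprimep_root2 cuv vc)).
(* As v is nonzero at c, the order of B there exceeds that of t^(ds-1) by at most 1. *)
have := mup_deriv c B0 dB0; rewrite dB mupMl; last by rewrite /root horner_exp expf_neq0.
rewrite mupMr ?rootC //; have [->|c0] := eqVneq c 0.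
  have X1 : mup 0 ('X : {poly K}) = 1%N.
    by have := mup_XsubCX 1 (0 : K) 0; rewrite expr1 polyC0 subr0 eqxx.
  rewrite !mup_exp ?polyX_eq0 // X1 !muln1 prednK // => le1.
  exact: leq_trans le1 (leq_addr _ _).
rewrite [mup c ('X^_)]mupNroot; last by rewrite /root horner_exp hornerX expf_neq0.
have [c1 le1|c1] := eqVneq (c ^+ (d * s)) 1.
  by rewrite (leq_trans le1) // ltn_addl // mup_XnsubC1.
(* The zero would be simple, yet r > 1 divides its order. *)
have [_ _ _] := curve_mup_dvd rs s0 cuv u0 v0 a0 b0 A0 B0 E c0 c1.
have mB : (0 < mup c (facB s d u v))%N by rewrite mup_geq1.
by move/(dvdn_leq mB) => /(leq_trans r1); rewrite ltnNge => /negPf ->.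
Qed.

(** * Points where A or B is identically zero *)

(** g divides f^s and is coprime to it, hence constant. *)
Lemma degree_coprimep_exp (K : fieldType) (s : nat) (f g h : {poly K}) :
  (0 < s)%N -> coprimep f g -> f ^+ s = h * g ^+ s -> degree g = 0%N.
Proof.
move=> s0 cfg E; have gf : g %| f ^+ s.
  by rewrite E dvdp_mull // -(prednK s0) exprS dvdp_mulr.
have := coprimep_dvdr gf (coprimep_expl s cfg).
by rewrite coprimepp /degree => /eqP ->.
Qed.

Lemma facA_eq0 (K : fieldType) (s : nat) (u v : {poly K}) :
  (0 < s)%N -> coprimep u v -> facA s u v = 0 -> degree u = 0%N /\ degree v = 0%N.
Proof.
move=> s0 cuv /eqP; rewrite addr_eq0 -mulN1r => /eqP E.
have dv := degree_coprimep_exp s0 cuv E; split=> //.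
move: (congr1 (@degree K) E); rewrite mulN1r degreeN !degree_exp dv => /eqP.
by rewrite mul0n muln_eq0 (gtn_eqF s0) orbF => /eqP.
Qed.

Lemma facB_eq0 (K : fieldType) (s d : nat) (u v : {poly K}) :
  (0 < s)%N -> coprimep u v -> v != 0 -> facB s d u v = 0 ->
  degree u = d /\ degree v = 0%N.
Proof.
move=> s0 cuv v0 /eqP; rewrite addr_eq0 -mulNr => /eqP E.
have dv := degree_coprimep_exp s0 cuv E; split=> //.
move: (congr1 (@degree K) E); rewrite mulNr degreeN degreeM ?expf_neq0 ?polyX_eq0 //.
by rewrite degree_Xn !degree_exp dv addn0 => /eqP; rewrite eqn_pmul2r // => /eqP.
Qed.

(** * Extension of the constant field *)

Lemma facA_map (F K : fieldType) (f : {rmorphism F -> K}) (s : nat) (u v : {poly F}) :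
  map_poly f (facA s u v) = facA s (map_poly f u) (map_poly f v).
Proof. by rewrite rmorphD !rmorphXn. Qed.

Lemma facB_map (F K : fieldType) (f : {rmorphism F -> K}) (s d : nat) (u v : {poly F}) :
  map_poly f (facB s d u v) = facB s d (map_poly f u) (map_poly f v).
Proof. by rewrite rmorphD rmorphM !rmorphXn /= map_polyX. Qed.

Lemma wronskian_map (F K : fieldType) (f : {rmorphism F -> K}) (u v : {poly F}) :
  map_poly f (wronskian u v) = wronskian (map_poly f u) (map_poly f v).
Proof. by rewrite /wronskian rmorphB !rmorphM /= !deriv_map. Qed.

Lemma degree_map (F K : fieldType) (f : {rmorphism F -> K}) (u : {poly F}) :
  degree (map_poly f u) = degree u.
Proof. by rewrite /degree size_map_poly. Qed.

(** * From rational functions to polynomials *)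

Lemma curve_clear_denominators (K : fieldType) (r s : nat) (a b u v T : K) :
  b != 0 -> u != 0 -> v != 0 ->
  (a / b) ^+ r = ((u / v) ^+ s + 1) * ((u / v) ^+ s + T) / (u / v) ^+ s ->
  a ^+ r * (u * v) ^+ s = b ^+ r * ((u ^+ s + v ^+ s) * (u ^+ s + T * v ^+ s)).
Proof.
move=> b0 u0 v0; rewrite !expr_div_n exprMn.
have := expf_neq0 r b0; have := expf_neq0 s u0; have := expf_neq0 s v0.
move: (a ^+ r) (b ^+ r) (u ^+ s) (v ^+ s) => A B U V V0 U0 B0.
by move/(canRL (divfK B0)) => ->; field; rewrite U0 V0.
Qed.

Lemma on_curve_poly (F : fieldType) (r s d : nat) (x y : ratfun F) (u v : {poly F}) :
  v != 0 -> x = poly_ratfun u / poly_ratfun v -> on_curve r s d (Some x, Some y) ->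
  u != 0 /\ exists a b : {poly F}, b != 0 /\
    a ^+ r * (u * v) ^+ s = b ^+ r * (facA s u v * facB s d u v).
Proof.
rewrite /poly_ratfun => v0 -> [x0 E].
have u0 : u != 0 by apply: contraNneq x0 => ->; rewrite tofrac0 mul0r.
split=> //; have [a [b [b0 Ey]]] := fraction_repr y.
exists a, b; split=> //; apply/eqP; rewrite -tofrac_eq; apply/eqP.
have bF0 : tofrac b != 0 by rewrite tofrac_eq0.
have uF0 : tofrac u != 0 by rewrite tofrac_eq0.
have vF0 : tofrac v != 0 by rewrite tofrac_eq0.
rewrite /facA /facB !(tofracM, tofracD, tofracXn).
apply: (curve_clear_denominators (K := ratfun F) bF0 uF0 vF0).
by rewrite Ey in E; exact: E.
Qed.

Lemma power_cross_mul (K : fieldType) (p : nat) (u v n m : K) :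
  v != 0 -> m != 0 -> u / v = (n / m) ^+ p -> u * m ^+ p = n ^+ p * v.
Proof.
move=> v0 m0 /eqP; rewrite expr_div_n eqr_div ?expf_neq0 //; exact/eqP.
Qed.

(** The Wronskian is v^2 times the derivative of x, which vanishes exactly on p-th powers since F is
    perfect. *)
Lemma is_power_wronskian (F : finFieldType) (p : nat) (x : ratfun F) (u v : {poly F}) :
  p \in [pchar F] -> v != 0 -> coprimep u v -> x = poly_ratfun u / poly_ratfun v ->
  is_power p x <-> wronskian u v = 0.
Proof.
rewrite /poly_ratfun => pF v0 cuv Ex.
have vF0 : tofrac v != 0 by rewrite tofrac_eq0.
split=> [[z Ez]|w0]; last first.
  have [du dv] := wronskian_eq0 cuv w0.
  have [a Ea] := deriv0_exp pF du; have [b Eb] := deriv0_exp pF dv.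
  by exists (tofrac a / tofrac b); rewrite Ex Ea Eb !tofracXn expr_div_n.
have [n [m [m0 Em]]] := fraction_repr z.
have mF0 : tofrac m != 0 by rewrite tofrac_eq0.
have E : u * m ^+ p = n ^+ p * v.
  apply/eqP; rewrite -tofrac_eq !tofracM !tofracXn; apply/eqP.
  apply: (power_cross_mul (K := ratfun F) vF0 mF0).
  by rewrite Ex Em in Ez; exact: Ez.
have dp (h : {poly F}) : (h ^+ p)^`() = 0.
  by rewrite deriv_exp -mulr_natr -polyC_natr (pcharf0 pF) mulr0.
have dE : u^`() * m ^+ p = n ^+ p * v^`().
  by move: (congr1 (@deriv F) E); rewrite !derivM !dp mulr0 mul0r addr0 add0r.
(* Multiplied by m^p, both terms of the Wronskian become n^p v v'. *)
apply: (mulIf (expf_neq0 p m0)); rewrite mul0r /wronskian mulrBl.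
by rewrite mulrAC dE [u * _ * _]mulrAC E mulrAC subrr.
Qed.

(** * Integer bounds on delta over F *)

Lemma curve_bounds (F : finFieldType) (p r s d : nat) (u v a b : {poly F}) :
  p \in [pchar F] -> (1 < r)%N -> (0 < s)%N -> (0 < d)%N ->
  coprime r s -> coprime s p -> coprime d p ->
  coprimep u v -> u != 0 -> v != 0 -> b != 0 ->
  a ^+ r * (u * v) ^+ s = b ^+ r * (facA s u v * facB s d u v) ->
  let delta := maxn (degree u) (degree v) in
  if wronskian u v == 0 then (delta <= 2 * d)%N
  else ((r - 1) * s * delta < 2 * delta + d * ((r - 1) * s))%N.
Proof.
move=> pF r1 s0 d0 rs sp dp cuv u0 v0 b0 E /=.
have r0 := ltnW r1; have pp := pcharf_prime pF.
have [B0|B0] := eqVneq (facB s d u v) 0.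
  (* Here delta = d, and d > 0 makes the second bound strict. *)
  have [-> ->] := facB_eq0 s0 cuv v0 B0; rewrite maxn0.
  by case: ifP => _; nia.
have [A0|A0] := eqVneq (facA s u v) 0.
  have [-> ->] := facA_eq0 s0 cuv A0; rewrite maxn0.
  case: ifP => _ //; rewrite !muln0 add0n !muln_gt0 d0 s0 subn_gt0 r1 //.
have a0 : a != 0.
  apply: contra_eq_neq E => ->; rewrite expr0n gtn_eqF // mul0r eq_sym.
  by rewrite !mulf_neq0 ?expf_neq0.
have [K [f _]] := countable_algebraic_closure F.
have natK n : coprime n p -> n%:R != 0 :> K.
  move=> np; rewrite -(rmorph_nat f) fmorph_eq0 -(dvdn_pcharf pF).
  by rewrite -prime_coprime // coprime_sym.
have m0 (h : {poly F}) : h != 0 -> map_poly f h != 0 by rewrite map_poly_eq0.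
have EK : map_poly f a ^+ r * (map_poly f u * map_poly f v) ^+ s =
    map_poly f b ^+ r * (facA s (map_poly f u) (map_poly f v) *
                         facB s d (map_poly f u) (map_poly f v)).
  by rewrite -facA_map -facB_map -!rmorphXn -!rmorphM -!rmorphXn -!rmorphM /= E.
have cK : coprimep (map_poly f u) (map_poly f v) by rewrite coprimep_map.
have BK : facB s d (map_poly f u) (map_poly f v) != 0 by rewrite -facB_map m0.
have AK : facA s (map_poly f u) (map_poly f v) != 0 by rewrite -facA_map m0.
rewrite -(degree_map f u) -(degree_map f v).
case: eqP => [/(wronskian_eq0 cuv)[du dv]|/eqP w0].
  apply: (inseparable_bound r1 d0 rs _ cK _ _ _ _ AK BK _ _ EK); rewrite ?m0 //.
  - by rewrite natK // coprimeMl dp.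
  - by rewrite deriv_map du rmorph0.
  - by rewrite deriv_map dv rmorph0.
have := separable_bound r0 d0 rs (natK s sp) cK (m0 _ u0) (m0 _ v0) (m0 _ a0) (m0 _ b0) BK.
rewrite -wronskian_map => /(_ (m0 _ w0) EK) lt; apply: leq_trans lt _.
(* deg u + deg v <= 2 delta. *)
by rewrite leq_add2r mul2n -addnn leq_add ?leq_maxl ?leq_maxr.
Qed.

Unset Implicit Arguments.

(** * Rational form of the bounds *)

Theorem mainTheorem5 (p q : nat) (hp : prime p)
    (hq : exists2 e : nat, (0 < e)%N & q = (p ^ e)%N)
    (F : finFieldType) (hF : #|F| = q)
    (r s d g : nat) (hr : (0 < r)%N) (hs : (0 < s)%N)
    (hrs : coprime r s) (hrp : coprime r p) (hsp : coprime s p)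
    (hd : (1 <= d)%N) (hdp : coprime d p)
    (hg : g = ((r - 1) * s)%N) (hg2 : (2 < g)%N)
    (x : ratfun F) (y : option (ratfun F))
    (hxy : on_curve r s d (Some x, y))
    (u v : {poly F}) (hv : v != 0) (huv : coprimep u v)
    (hx : x = poly_ratfun u / poly_ratfun v)
    (delta : nat) (hdelta : delta = maxn (degree u) (degree v)) :
  (~ is_power p x ->
     (delta%:R : rat) <= (d%:R * g%:R - 1) / (g%:R - 2)) /\
  (is_power p x ->
     (delta%:R : rat) <= (2 * d%:R * (g%:R - 1) - 1) / (g%:R - 2)).
Proof.
have pF : p \in [pchar F] by have [e _ Eq] := hq; apply: (@card_finPcharP F p e); rewrite ?hF.
have g2 : 0 < g%:R - 2 :> rat by rewrite subr_gt0 (ltr_nat rat 2).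
have bound : (delta * g < 2 * delta + d * g)%N ->
    (delta%:R : rat) <= (d%:R * g%:R - 1) / (g%:R - 2).
  move=> lt; rewrite ler_pdivlMr //.
  have : (delta * g + 1)%:R <= (2 * delta + d * g)%:R :> rat by rewrite ler_nat; lia.
  by rewrite !natrD !natrM; lra.
have bound_p : (delta <= 2 * d)%N ->
    (delta%:R : rat) <= (2 * d%:R * (g%:R - 1) - 1) / (g%:R - 2).
  move=> le; rewrite ler_pdivlMr //.
  (* 2d(g-2) = 2d(g-1) - 2d, and 2d >= 1. *)
  have : (delta * g + 2 * d + 1)%:R <= (2 * delta + 2 * d * g)%:R :> rat.
    by rewrite ler_nat; nia.
  by rewrite !natrD !natrM; lra.
have wP := is_power_wronskian pF hv huv hx.
(* A pole of y at finite x has x = 0, so v is constant and delta = 0. *)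
case: y hxy => [y|] hxy; last first.
  have u0 : u = 0.
    apply/eqP; rewrite -tofrac_eq0; move/eqP: (hxy); rewrite hx mulf_eq0 invr_eq0.
    by rewrite /poly_ratfun (negPf (_ : tofrac v != 0)) ?orbF // tofrac_eq0.
  have delta0 : delta = 0%N.
    move: huv; rewrite hdelta u0 coprime0p -size_poly_eq1 => /eqP sv.
    by rewrite /degree sv size_poly0.
  by split=> _; [apply: bound | apply: bound_p]; rewrite delta0; lia.
have [u0 [a [b [b0 E]]]] := on_curve_poly hv hx hxy.
(* r = 1 would give g = 0. *)
have r1 : (1 < r)%N by case: r hg hr {hrs hrp hxy E} => [|[|r']] //=; lia.
have := curve_bounds pF r1 hs hd hrs hsp hdp huv u0 hv b0 E; rewrite /= -hdelta -hg.
case: eqP => w le; split=> px; try by [case: (px); apply/wP | apply: bound_p].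
  by apply: bound; lia.
by case: w; apply/wP.
Qed.
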